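(* Let $\mathcal{D}=\prod_{r=1}^d\mathcal{D}_r$ be a product distribution on $[n]^d$ and $\varepsilon\le 1/10$. For $r\in[d]$ and $j\in[n]$ let $\theta_r^j=\min\big(\sum_{k\le j}\mu_{\mathcal{D}_r}(k),\,1-\sum_{k\le j}\mu_{\mathcal{D}_r}(k)\big)$ and $\theta_r=\max_{1\le j\le n}\theta_r^j$. Any monotonicity tester on the hypergrid $[n]^d$ (functions $f:[n]^d\to\mathbb{N}$) with respect to $\mathcal{D}$ with proximity parameter $\varepsilon$ makes $\Omega\big(\sum_{r=1}^d\theta_r\big)$ queries.
   Context: $\mu_{\mathcal{D}_r}(k)$ is the probability of $k$ under $\mathcal{D}_r$. $f$ is monotone if $f(x)\le f(y)$ whenever $x\le y$ coordinatewise. A monotonicity tester w.r.t. $\mathcal{D}$ with proximity parameter $\varepsilon$ (possibly adaptive, two-sided error) accepts monotone $f$ with probability $>2/3$ and rejects with probability $>2/3$ every $f$ with $\min_{g\text{ monotone}}\Pr_{x\sim\mathcal{D}}[f(x)\ne g(x)]>\varepsilon$. *)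

(* Defs.v *)
From HB Require Import structures.
From mathcomp Require Import all_boot all_order all_algebra.
From mathcomp Require Import all_classical all_reals.
From mathcomp Require Import measure probability.

Set Implicit Arguments.
Unset Strict Implicit.
Unset Printing Implicit Defensive.
Import Order.TTheory GRing.Theory Num.Theory.
Local Open Scope ring_scope.
Local Open Scope classical_set_scope.

(* The hypergrid [n]^d: points are functions from coordinates 'I_d to
   values 'I_n (value k : 'I_n stands for k+1 in [n]). *)
Definition grid (n d : nat) := {ffun 'I_d -> 'I_n}.

Definition monotone_fun (n d : nat) (f : grid n d -> nat) : Prop :=
  forall x y : grid n d, (forall i, (x i <= y i)%N) -> (f x <= f y)%N.

Definition prodPr (R : realType) (n d : nat) (mu : 'I_d -> 'I_n -> R)
  (A : pred (grid n d)) : R :=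
  \sum_(x : grid n d | A x) \prod_(r < d) mu r (x r).

Definition is_prod_distr (R : realType) (n d : nat) (mu : 'I_d -> 'I_n -> R) : Prop :=
  (forall r k, 0 <= mu r k) /\ (forall r, \sum_(k < n) mu r k = 1).

Definition far_from_monotone (R : realType) (n d : nat) (mu : 'I_d -> 'I_n -> R)
  (eps : R) (f : grid n d -> nat) : Prop :=
  forall g : grid n d -> nat, monotone_fun g ->
    eps < prodPr mu (fun x => f x != g x).

Definition cdf (R : realType) (n d : nat) (mu : 'I_d -> 'I_n -> R) (r : 'I_d) (j : 'I_n) : R :=
  \sum_(k < n | (k <= j)%N) mu r k.

Definition theta_rj (R : realType) (n d : nat) (mu : 'I_d -> 'I_n -> R) (r : 'I_d) (j : 'I_n) : R :=
  Num.min (cdf mu r j) (1 - cdf mu r j).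

(* theta_r = max_{1 <= j <= n} theta_r^j (all theta_r^j are >= 0). *)
Definition theta_r (R : realType) (n d : nat) (mu : 'I_d -> 'I_n -> R) (r : 'I_d) : R :=
  \big[Num.max/0]_(j < n) theta_rj mu r j.

(* Deterministic adaptive query algorithms: decision trees that query a
   point of X, receive a natural number, and finally accept/reject. *)
Inductive dtree (X : Type) : Type :=
| DLeaf : bool -> dtree X
| DQuery : X -> (nat -> dtree X) -> dtree X.

Arguments DLeaf {X}.
Arguments DQuery {X}.

Fixpoint run (X : Type) (t : dtree X) (f : X -> nat) : bool :=
  match t with
  | DLeaf b => b
  | DQuery x k => run (k (f x)) f
  end.

Fixpoint query_bounded (X : Type) (q : nat) (t : dtree X) : Prop :=
  match t with
  | DLeaf _ => True
  | DQuery _ k =>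
      match q with
      | 0 => False
      | q'.+1 => forall a, query_bounded q' (k a)
      end
  end.

(* A randomized (adaptive, two-sided error) algorithm is a random decision
   tree T : Omega -> dtree X over a probability space (Omega, P).  It is a
   monotonicity tester w.r.t. D with proximity parameter eps if it accepts
   monotone f with probability > 2/3 and rejects eps-far f w.p. > 2/3. *)
Definition is_monotonicity_tester (R : realType) (n d : nat)
  (mu : 'I_d -> 'I_n -> R) (eps : R)
  (dd : measure_display) (Omega : measurableType dd) (P : probability Omega R)
  (T : Omega -> dtree (grid n d)) : Prop :=
  (forall f : grid n d -> nat, measurable [set w | run (T w) f]) /\
  (forall f : grid n d -> nat, monotone_fun f ->
     ((2 / 3 : R)%:E < P [set w | run (T w) f])%E) /\
  (forall f : grid n d -> nat, far_from_monotone mu eps f ->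
     ((2 / 3 : R)%:E < P [set w | ~~ run (T w) f])%E).

(* Main.v *)
Require Import Defs.
From HB Require Import structures.
From mathcomp Require Import all_boot all_order all_algebra.
From mathcomp Require Import all_classical all_reals.
From mathcomp Require Import measure measurable_realfun numfun lebesgue_integral.
From mathcomp Require Import probability.
From mathcomp Require Import zify ring lra.
Set Implicit Arguments.
Unset Strict Implicit.
Unset Printing Implicit Defensive.
Import Order.TTheory GRing.Theory Num.Theory.

(* Call the lighter side of the threshold attaining theta_r the rare side of
   coordinate r, and keep only the coordinates whose rare side is the upper one,
   or only those whose rare side is the lower one, whichever carry at least half
   of the sum.  Group them greedily into m blocks, each of total rare mass in
   [1/4, 3/4]; "some coordinate of block i is on its rare side" is, up to a
   global negation, a monotone bit y_i(x).

   A random function orders the points by (y_{m-1}, ..., y_0) lexicographically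
   through base-B digits: the node (j, bits above j) carries a uniform label u
   in Z/B, and the j-th digit of x is u or u + 1 according to y_j(x).  When no
   label is -1 this function is monotone, and exchanging u and u + 1 on level i
   makes it far from monotone, since every change of the bit y_i alone is then
   inverted.  A single query sees one uniform digit per node, so a run
   distinguishes the two functions only if two of its queries have i as their
   topmost differing bit.  At most q indices i arise in this way from q queries,
   and B is taken so large that few labelings use -1, so averaging over i gives
   m <= 4 q. *)

(** * Query traces of decision trees *)

Fixpoint trace (X : Type) (t : dtree X) (f : X -> nat) : seq X :=
  if t is DQuery x k then x :: trace (k (f x)) f else [::].

Lemma size_trace (X : Type) (q : nat) (t : dtree X) (f : X -> nat) :
  query_bounded q t -> size (trace t f) <= q.
Proof.
elim: t q => [//|x k IH] [|q] //= bk.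
exact: IH (bk (f x)).
Qed.

Lemma trace_agree (X : eqType) (t : dtree X) (f g : X -> nat) :
  {in trace t f, f =1 g} -> trace t g = trace t f /\ run t g = run t f.
Proof.
elim: t => [//|x k IH] /= fg.
have <- : f x = g x by apply: fg; rewrite inE eqxx.
by case: (IH (f x)) => [z zt|-> ->//]; apply: fg; rewrite inE zt orbT.
Qed.

(** * Lexicographic digit sums and Bernoulli's inequality *)

Lemma lex_sum (b m : nat) (D D' : nat -> nat) (j : nat) :
  (forall k, D k < b) -> j < m -> D j < D' j ->
  (forall k, j < k < m -> D k = D' k) ->
  \sum_(k < m) D k * b ^ k < \sum_(k < m) D' k * b ^ k.
Proof.
move=> ltb; elim: m => [//|m IH] jm ltj eqab.
have low r : \sum_(k < r) D k * b ^ k < b ^ r.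
  elim: r => [|r IHr]; first by rewrite big_ord0.
  rewrite big_ord_recr /= expnS.
  apply: (@leq_trans (b ^ r + D r * b ^ r)); first by rewrite ltn_add2r.
  by rewrite -mulSn leq_mul2r ltb orbT.
rewrite !big_ord_recr /=.
move: jm; rewrite ltnS leq_eqVlt => /orP[/eqP jm|jm].
  subst m; apply: (@leq_trans (b ^ j + D j * b ^ j)); first by rewrite ltn_add2r low.
  by rewrite -mulSn (leq_trans _ (leq_addl _ _)) // leq_mul2r ltj orbT.
rewrite (eqab m) ?jm ?leqnn // ltn_add2r.
by apply: (IH jm ltj) => k /andP[jk km]; apply: eqab; rewrite jk ltnW.
Qed.

(** This is (1 - 1/(b+1))^M >= 1 - M/(b+1) with denominators cleared; truncated subtraction makes
    large [M] trivial. *)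
Lemma bernoulli_expn (b M : nat) : b.+1 ^ M * (b.+1 - M) <= b ^ M * b.+1.
Proof.
elim: M => [|M IH]; first by rewrite !expn0 subn0.
rewrite !expnS subSS; have [leM|ltM] := leqP b M.
  by rewrite (eqP leM) muln0.
apply: (@leq_trans (b * (b.+1 ^ M * (b.+1 - M)))); last by rewrite -mulnA leq_mul2l IH orbT.
rewrite (subSn (ltnW ltM)) mulnAC [leqRHS]mulnCA [leqRHS]mulnC leq_mul2r; apply/orP; right.
by rewrite mulSn mulnS leq_add2r leq_subr.
Qed.

(** * Random digit functions on the tree of bit prefixes *)

Section Trie.

Variables (X : finType) (m b : nat) (y : X -> 'I_m -> bool).

Local Notation node := ('I_m * {ffun 'I_m -> bool})%type.
Local Notation labeling := {ffun node -> 'I_b.+2}.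

(** The bits above [j] are padded with [false] to full length, so that nodes of all levels share one
    finite type. *)
Definition trie_node (j : 'I_m) (x : X) : node :=
  (j, [ffun k : 'I_m => (j < k) && y x k]).

Lemma trie_nodeP (j : 'I_m) (x z : X) :
  reflect (forall k : 'I_m, j < k -> y x k = y z k) (trie_node j x == trie_node j z).
Proof.
apply: (iffP eqP) => [[/ffunP e] k jk|e]; first by have := e k; rewrite !ffunE jk.
by congr (_, _); apply/ffunP => k; rewrite !ffunE; case: ltnP => //= /e.
Qed.

Definition digit (c : option 'I_m) (U : labeling) (j : 'I_m) (x : X) : 'I_b.+2 :=
  let u := U (trie_node j x) in
  if y x j (+) (c == Some j) then (u + 1)%R else u.

Definition trie_fun (c : option 'I_m) (U : labeling) (x : X) : nat :=
  \sum_(j < m) digit c U j x * b.+2 ^ j.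

(** Only the label -1 makes u + 1 wrap around to 0, which would invert the order of the two
    digits. *)
Definition unwrapped (U : labeling) : bool := [forall p, U p != (-1)%R].

Definition separates (i : 'I_m) (x z : X) : bool :=
  (trie_node i x == trie_node i z) && (y x i != y z i).

Definition hits (Q : seq X) (i : 'I_m) : bool :=
  has (fun x => has (separates i x) Q) Q.

(** Separated points share the nodes and bits above level [j], hence those digits. At [j] they share
    a label u, and their digits are u and u + 1 without wraparound. *)
Lemma trie_fun_lt (c : option 'I_m) (U : labeling) (j : 'I_m) (x z : X) :
  separates j x z -> unwrapped U -> y x j (+) (c == Some j) = false ->
  trie_fun c U x < trie_fun c U z.
Proof.
move=> /andP[/eqP nodeE yj] /forallP/(_ (trie_node j x)) Un1 yjF.
have above (k : 'I_m) : j < k -> digit c U k x = digit c U k z.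
  move=> jk; have /trie_nodeP e : trie_node j x == trie_node j z by apply/eqP.
  rewrite /digit e //; suff -> : trie_node k x = trie_node k z by [].
  by apply/eqP/trie_nodeP => l kl; apply: e; apply: ltn_trans kl.
have at_j : digit c U j x < digit c U j z.
  have yjT : y z j (+) (c == Some j) = true.
    by move: yj yjF; case: (y x j); case: (y z j); case: (c == _).
  rewrite /digit yjF yjT -nodeE; move: Un1; set u := U _ => un1.
  have : val u != b.+1 by apply: contraNneq un1 => ub; apply/eqP/val_inj; rewrite /= ub !modn_small.
  move=> ub; rewrite /= (modn_small (isT : 1 < b.+2)) modn_small ?addn1 //.
  by rewrite ltn_neqAle eqSS ub ltn_ord.
(* [lex_sum] takes digits indexed by [nat]; the default 0 beyond [m] stays below the base. *)
pose ext (w : X) (k : nat) : nat := if insub k is Some k' then val (digit c U k' w) else 0.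
have extE w : trie_fun c U w = \sum_(k < m) ext w k * b.+2 ^ k.
  by apply: eq_bigr => k _; rewrite /ext valK.
rewrite !extE; apply: (@lex_sum b.+2 m (ext x) (ext z) j) => //.
- by move=> k; rewrite /ext; case: insub => [k'|] //; apply: ltn_ord.
- by rewrite /ext valK.
- move=> k /andP[jk km]; rewrite -[k]/(val (Ordinal km)) /ext !valK.
  by rewrite above.
Qed.

Lemma trie_fun_eq (c : option 'I_m) (U : labeling) (x z : X) :
  y x =1 y z -> trie_fun c U x = trie_fun c U z.
Proof.
move=> e; apply: eq_bigr => j _; rewrite /digit e.
by suff -> : trie_node j x = trie_node j z by []; apply/eqP/trie_nodeP => k _.
Qed.

Lemma trie_fun_mono (U : labeling) (x z : X) :
  unwrapped U -> (forall j, y x j ==> y z j) -> trie_fun None U x <= trie_fun None U z.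
Proof.
move=> goodU yxz.
case: (pickP (fun j => y x j != y z j)) => [j0 j0P|eqy]; last first.
  by rewrite (@trie_fun_eq None U x z) // => j; apply/eqP; have /negbFE := eqy j.
case: (@arg_maxnP _ j0 (fun j => y x j != y z j) val j0P) => j yj maxj.
apply/ltnW/(@trie_fun_lt _ _ j) => //.
  rewrite /separates yj andbT; apply/trie_nodeP => k jk; apply/eqP/negbNE/negP => yk.
  by have := maxj k yk; rewrite /geq /= leqNgt jk.
by move: yj (yxz j); case: (y x j); case: (y z j).
Qed.

(* A new query x creates at most one new index: if x is separated from z at i
   and from z' at a smaller index, then z and z' are already separated at i. *)
Lemma card_hits (Q : seq X) : #|hits Q| <= size Q.
Proof.
elim: Q => [|x Q IH] /=.
  by rewrite (eq_card0 (A := hits [::])).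
have sym i w z : separates i w z = separates i z w.
  by rewrite /separates eq_sym [y w i == _]eq_sym.
have hitsE i : hits (x :: Q) i -> has (separates i x) Q || hits Q i.
  rewrite /hits /= (_ : separates i x x = false); last by rewrite /separates !eqxx.
  rewrite orFb.
  case/orP => [->//|/hasP[z zQ /=]].
  case/orP => [sz|sz]; first by apply/orP; left; apply/hasP; exists z; rewrite // sym.
  by apply/orP; right; apply/hasP; exists z.
case: (pickP (fun i => has (separates i x) Q)) => [i0 i0P|none]; last first.
  apply: leq_trans (leqW IH); apply: subset_leq_card; apply/fintype.subsetP => i.
  by rewrite !unfold_in => /hitsE; rewrite none.
case: (@arg_minnP _ i0 (fun i => has (separates i x) Q) val i0P) => j /hasP[z' z'Q sz'] minj.
apply: (@leq_trans #|[predU1 j & hits Q]|); last first.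
  by rewrite cardU1 -add1n leq_add // leq_b1.
apply: subset_leq_card; apply/fintype.subsetP => i; rewrite !unfold_in /= => /hitsE/orP[ix|hi]; last by apply/orP; right.
have := minj i ix; rewrite leq_eqVlt => /orP[/eqP/val_inj->|ji]; first by rewrite eqxx.
apply/orP; right; have /hasP[z zQ /andP[/trie_nodeP ez yz]] := ix.
have /andP[/trie_nodeP ez' _] := sz'.
apply/hasP; exists z => //; apply/hasP; exists z' => //.
apply/andP; split; last by rewrite -(ez' i ji) eq_sym.
by apply/trie_nodeP => k ik; rewrite -ez // ez' // (ltn_trans ji).
Qed.

(** After the exchange a bit-0 query reads u + 1 and a bit-1 query reads u, so the label must drop
    by 1 or rise by 1 to hide it. If [i] is not hit, no node meets both kinds of query. *)
Definition shift (i : 'I_m) (Q : seq X) (p : node) : 'I_b.+2 :=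
  if p.1 != i then 0%R
  else if has (fun x => (trie_node i x == p) && ~~ y x i) Q then (-1)%R
  else if has (fun x => (trie_node i x == p) && y x i) Q then 1%R else 0%R.

Definition relabel (i : 'I_m) (Q : seq X) (U : labeling) : labeling :=
  [ffun p => (U p + shift i Q p)%R].

Lemma trie_fun_relabel (i : 'I_m) (Q : seq X) (U : labeling) :
  ~~ hits Q i -> {in Q, trie_fun None U =1 trie_fun (Some i) (relabel i Q U)}.
Proof.
move=> nh x xQ; apply: eq_bigr => j _; congr (val _ * _); rewrite /digit ffunE /shift /=.
have [->|ji] := eqVneq j i; last first.
  by rewrite (inj_eq Some_inj) [i == j]eq_sym (negPf ji) GRing.addr0.
rewrite eqxx; case yx: (y x i) => /=.
  rewrite ifF ?ifT //; first by apply/hasP; exists x; rewrite // eqxx yx.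
  apply: contraNF nh => /hasP[z zQ /andP[ez yz]]; apply/hasP; exists x => //.
  by apply/hasP; exists z; rewrite // /separates eq_sym ez yx (negPf yz).
by rewrite ifT ?GRing.subrK //; apply/hasP; exists x; rewrite // eqxx yx.
Qed.

(** Relabeling along the trace injects the accepting labelings without a hit into the accepting
    labelings of the exchanged function. *)
Lemma card_accept (t : dtree X) (i : 'I_m) :
  #|[pred U | run t (trie_fun None U)]| <=
  #|[pred U | run t (trie_fun (Some i) U)]| + #|[pred U | hits (trace t (trie_fun None U)) i]|.
Proof.
set A := [pred U | _]; set H := [pred U | hits _ i]; set A' := [pred U | run t (trie_fun (Some i) U)].
rewrite -(cardID H A) addnC leq_add //; last first.
  by apply/subset_leq_card/fintype.subsetP => U /andP[].
pose tr U := trace t (trie_fun None U).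
pose sigma U := relabel i (tr U) U.
have agree U : U \notin H ->
    trace t (trie_fun (Some i) (sigma U)) = tr U /\
    run t (trie_fun (Some i) (sigma U)) = run t (trie_fun None U).
  by move=> nh; apply: trace_agree; apply: trie_fun_relabel.
rewrite -(@card_in_image _ _ sigma [predD A & H]) => [|U V /andP[UH _] /andP[VH _] e].
  apply: subset_leq_card; apply/fintype.subsetP => _ /fintype.imageP[U /andP[UH UA] ->].
  by rewrite inE (agree U UH).2.
(* The relabeled run has the same trace, so the shift can be read off the image and undone. *)
have trE : tr U = tr V by rewrite -(agree U UH).1 e (agree V VH).1.
apply/ffunP => p; move/ffunP/(_ p): e; rewrite !ffunE trE; exact: GRing.addIr.
Qed.

Lemma sum_accept (q : nat) (t : dtree X) : query_bounded q t ->
  m * #|[pred U | run t (trie_fun None U)]| <=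
  \sum_i #|[pred U | run t (trie_fun (Some i) U)]| + q * #|{: labeling}|.
Proof.
move=> bt; apply: (@leq_trans (\sum_i (#|[pred U | run t (trie_fun (Some i) U)]| +
   #|[pred U | hits (trace t (trie_fun None U)) i]|))).
  by rewrite -{1}[m]card_ord -sum_nat_const; apply: leq_sum => i _; apply: card_accept.
rewrite big_split leq_add2l /=.
under eq_bigr do rewrite -sum1_card big_mkcond.
rewrite exchange_big /= mulnC -sum_nat_const; apply: leq_sum => U _.
rewrite -big_mkcond sum1_card.
exact: leq_trans (card_hits _) (size_trace _ bt).
Qed.

(** By Bernoulli, the labelings using -1 form a fraction of at most M/(b+2) <= 1/16, with [M] the
    number of nodes. *)
Lemma card_unwrapped : 16 * #|{: node}| <= b.+2 ->
  15 * #|{: labeling}| <= 16 * #|unwrapped|.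
Proof.
set M := #|_| => Mb.
have -> : #|unwrapped| = b.+1 ^ M.
  rewrite (eq_card (B := ffun_on [pred u | u != (-1)%R])) => [|U]; last first.
    apply/idP/ffun_onP => [|h]; first by rewrite unfold_in => /forallP.
    by rewrite unfold_in; apply/forallP.
  rewrite card_ffun_on (_ : #|_| = b.+1) //.
  by have := cardC1 (-1 : 'I_b.+2)%R; rewrite card_ord.
rewrite card_ffun card_ord.
have := bernoulli_expn b.+1 M.
by move: Mb; set p := _ ^ _; set r := _ ^ _; clearbody M p r; nia.
Qed.

End Trie.

(** * Product measures: union bound and resampling *)

Local Open Scope ring_scope.

(** A union bound for independent events; the bound by 1 strengthens the induction. *)
Lemma prod_1B_ge (R : realDomainType) (I : Type) (l : seq I) (a : I -> R) :
  (forall i, 0 <= a i <= 1) -> 1 - \sum_(i <- l) a i <= \prod_(i <- l) (1 - a i) <= 1.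
Proof.
move=> a01; elim: l => [|i l /andP[IH1 IH2]]; first by rewrite !big_nil subr0 lexx.
rewrite !big_cons; have /andP[a0 a1] := a01 i.
have P0 : 0 <= \prod_(j <- l) (1 - a j).
  by apply: prodr_ge0 => j _; rewrite subr_ge0; case/andP: (a01 j).
by move: IH1 IH2 P0; set P := \prod_(j <- l) _; set S := \sum_(j <- l) _ => *; nra.
Qed.

Section Resampling.

Variables (R : realType) (n d : nat) (mu : 'I_d -> 'I_n -> R).
Hypothesis muP : is_prod_distr mu.

Definition weight (x : grid n d) : R := \prod_(r < d) mu r (x r).

Definition upd (x : grid n d) (r : 'I_d) (k : 'I_n) : grid n d :=
  [ffun s => if s == r then k else x s].

Lemma weight_ge0 x : 0 <= weight x.
Proof. by apply: prodr_ge0 => r _; apply: muP.1. Qed.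

Lemma updK x r k : upd (upd x r k) r (x r) = x.
Proof. by apply/ffunP => s; rewrite !ffunE; case: eqP => [->|]. Qed.

Lemma weight_upd x r k : weight (upd x r k) * mu r (x r) = weight x * mu r k.
Proof.
rewrite /weight (bigD1 r) //= [in RHS](bigD1 r) //= ffunE eqxx.
rewrite (eq_bigr (fun s => mu s (x s))) => [|s /negPf sr]; last by rewrite ffunE sr.
by set p := \prod_(i | _) _; ring.
Qed.

Variables (B : pred 'I_d) (rare : 'I_d -> pred 'I_n).

Definition flag (x : grid n d) : bool := [exists r, B r && rare r (x r)].

Definition rare_mass (r : 'I_d) : R := \sum_(k < n | rare r k) mu r k.

Local Notation S := (\sum_(r | B r) rare_mass r).

Lemma rare_mass_ge0 r : 0 <= rare_mass r.
Proof. by apply: sumr_ge0 => k _; apply: muP.1. Qed.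

Lemma weight_unflagged : 1 - S <= \sum_(x | ~~ flag x) weight x.
Proof.
pose Q r : pred 'I_n := fun k => ~~ (B r && rare r k).
have -> : \sum_(x | ~~ flag x) weight x = \prod_r \sum_(k | Q r k) mu r k.
  rewrite bigA_distr_big_dep.
  apply: eq_bigl => x; rewrite /flag negb_exists.
  by apply/forallP/familyP => h r; have := h r.
pose a r := if B r then rare_mass r else 0.
have aE r : \sum_(k | Q r k) mu r k = 1 - a r.
  rewrite -(muP.2 r) /a /Q; case: (B r) => /=; last by rewrite subr0.
  by rewrite [in RHS](bigID (rare r)) /= addrAC subrr add0r.
rewrite (eq_bigr _ (fun r _ => aE r)) [X in 1 - X]big_mkcond /=.
have a01 r : 0 <= a r <= 1.
  rewrite -(muP.2 r) /a; case: (B r); last by rewrite lexx (muP.2 r) ler01.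
  rewrite rare_mass_ge0 /= [leRHS](bigID (rare r)) /= lerDl.
  by apply: sumr_ge0 => k _; apply: muP.1.
by have /andP[] := prod_1B_ge (index_enum 'I_d) a01.
Qed.

(** For distinct [r] in [B] these events are disjoint, so their masses add up inside the flagged
    event. *)
Definition only_rare (r : 'I_d) (x : grid n d) : bool :=
  rare r (x r) && [forall s, B s && (s != r) ==> ~~ rare s (x s)].

Lemma sum_only_rare (E : pred (grid n d)) :
  \sum_(r | B r) \sum_(x | only_rare r x && E x) weight x <=
  \sum_(x | flag x && E x) weight x.
Proof.
rewrite (exchange_big_dep predT) //= [leRHS]big_mkcond /=.
apply: ler_sum => x _.
case: (pickP (fun r => B r && (only_rare r x && E x))) => [r /[dup] rP /and3P[Br /andP[rr ors] Ex]|none].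
  rewrite (bigD1 r) //= big1 => [|s /andP[/and3P[Bs /andP[rs _] _] sr]].
    by rewrite addr0 ifT // Ex andbT; apply/existsP; exists r; rewrite Br.
  by move/forallP/(_ s): ors; rewrite Bs sr rs.
by rewrite big_pred0 //; case: ifP => // _; apply: weight_ge0.
Qed.

Lemma resample_le (r : 'I_d) (E : pred (grid n d)) : B r ->
  \sum_(x | ~~ flag x) \sum_(k | rare r k && E (upd x r k)) weight x * mu r k <=
  \sum_(x | only_rare r x && E x) weight x.
Proof.
move=> Br; rewrite pair_big_dep /=.
(* Swapping [x r] with the fresh value [k] is an involution preserving the joint weight of [x] and
   [k]. *)
pose tau (p : grid n d * 'I_n) := (upd p.1 r p.2, p.1 r).
have tauK : involutive tau.
  by case=> x k; rewrite /tau /= updK ffunE eqxx.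
rewrite (reindex_inj (inv_inj tauK)) /=.
have -> : \sum_(x | only_rare r x && E x) weight x =
    \sum_(p | only_rare r p.1 && E p.1) weight p.1 * mu r p.2.
  transitivity (\sum_(x | only_rare r x && E x) \sum_k weight x * mu r k).
    by apply: eq_bigr => x _; rewrite -mulr_sumr (muP.2 r) mulr1.
  by rewrite pair_big; apply: eq_bigl => p; rewrite andbT.
rewrite [leLHS]big_mkcond [leRHS]big_mkcond /=; apply: ler_sum => -[x k] _ /=.
rewrite weight_upd updK; case: ifP => [/and3P[nf rr Ex]|_]; last first.
  by case: ifP => // _; rewrite mulr_ge0 ?weight_ge0 ?muP.1.
rewrite ifT // /only_rare rr Ex andbT /=; apply/forallP => s; apply/implyP => /andP[Bs sr].
by apply: contra nf => rs; apply/existsP; exists s; rewrite Bs ffunE (negPf sr).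
Qed.

(* Resampling one coordinate of a block from its rare side pairs unflagged
   points with flagged ones, with total mass at least S (1 - S) and marginals
   dominated by the product measure. *)
Lemma resample_distance (E : pred (grid n d)) :
  S <= 1 ->
  (forall x r k, ~~ flag x -> B r -> rare r k -> E x || E (upd x r k)) ->
  S * (1 - S) <= prodPr mu E.
Proof.
move=> S1 EP.
have S0 : 0 <= S by apply: sumr_ge0 => r _; apply: rare_mass_ge0.
(* Each unflagged [x] charges its mass times [S] to itself if [E x], and otherwise to its
   resamplings, which then all satisfy [E]. *)
have W1 : \sum_(x | ~~ flag x) weight x * S <=
    \sum_(x | ~~ flag x && E x) weight x * S + \sum_(x | flag x && E x) weight x.
  apply: (@le_trans _ _ (\sum_(x | ~~ flag x && E x) weight x * S +
     \sum_(r | B r) \sum_(x | ~~ flag x) \sum_(k | rare r k && E (upd x r k)) weight x * mu r k)).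
    rewrite exchange_big big_mkcondr -big_split /=.
    apply: ler_sum => x nf.
    have T0 : 0 <= \sum_(r | B r) \sum_(k | rare r k && E (upd x r k)) weight x * mu r k.
      by do 2![apply: sumr_ge0 => ? _]; rewrite mulr_ge0 ?weight_ge0 ?muP.1.
    case: ifP => [_|nE]; first by rewrite lerDl.
    rewrite add0r mulr_sumr; apply: ler_sum => r Br; rewrite /rare_mass mulr_sumr.
    rewrite [leRHS](eq_bigl (rare r)) // => k; apply: andb_idr => rk.
    by have := EP x r k nf Br rk; rewrite nE.
  rewrite lerD2l; apply: le_trans (sum_only_rare E); apply: ler_sum => r Br.
  exact: resample_le.
have -> : prodPr mu E = \sum_(x | ~~ flag x && E x) weight x + \sum_(x | flag x && E x) weight x.
  by rewrite /prodPr (bigID flag) /= addrC; congr (_ + _); apply: eq_bigl => x; rewrite andbC.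
rewrite -!mulr_suml in W1; have := weight_unflagged.
have : 0 <= \sum_(x | ~~ flag x && E x) weight x by apply: sumr_ge0 => x _; apply: weight_ge0.
(* S (1 - S) <= a S <= e S + g <= e + g. *)
by move: W1 S0 S1; set s := S; set a := (\sum_(x | ~~ flag x) weight x); set e := (\sum_(x | ~~ _ && _) _);
  set g := (\sum_(x | _ && _) _); nra.
Qed.

End Resampling.

(** * Greedy grouping into blocks *)

Lemma greedy_blocks (R : realFieldType) (T : eqType) (h : T -> R) (l : seq T) :
  uniq l -> (forall r, 0 <= h r <= 1 / 2) ->
  exists m : nat, exists beta : T -> nat,
    [/\ forall b, (b < m)%N -> 1 / 4 <= \sum_(r <- l | beta r == b) h r <= 3 / 4,
        0 <= \sum_(r <- l | beta r == m) h r <= 1 / 4,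
        \sum_(r <- l | (m < beta r)%N) h r = 0 &
        \sum_(r <- l) h r <= 3 / 4 * m%:R + \sum_(r <- l | beta r == m) h r].
Proof.
move=> + h01; elim: l => [_|x l IH /= /andP[xl /IH{IH}[m [beta [full part over tot]]]]].
  by exists 0%N, (fun=> 0%N); split=> //; rewrite !big_nil ?mulr0 ?addr0 //; lra.
pose beta' s := if s == x then m else beta s.
have sumE (P : pred nat) : \sum_(r <- x :: l | P (beta' r)) h r =
    (if P m then h x else 0) + \sum_(r <- l | P (beta r)) h r.
  rewrite big_cons {1}/beta' eqxx.
  have -> : \sum_(r <- l | P (beta' r)) h r = \sum_(r <- l | P (beta r)) h r.
    rewrite [LHS]big_seq_cond [RHS]big_seq_cond; apply: eq_bigl => r.
    by rewrite /beta'; case: eqP => // ->; rewrite (negPf xl).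
  by case: ifP => _; rewrite ?add0r.
have /andP[hx0 hx1] := h01 x.
have fullE b : (b < m)%N -> \sum_(r <- x :: l | beta' r == b) h r = \sum_(r <- l | beta r == b) h r.
  by move=> bm; rewrite (sumE (eq_op^~ b)) gtn_eqF // add0r.
have partE := sumE (eq_op^~ m); rewrite eqxx in partE.
have overE := sumE (fun k => (m < k)%N); rewrite ltnn add0r over in overE.
(* Block [m] is the open one. It absorbs [x] and stays open up to mass 1/4; otherwise it closes,
   with mass at most 1/4 + 1/2. *)
have [small|big] := leP (\sum_(r <- x :: l | beta' r == m) h r) (1 / 4).
  exists m, beta'; split=> //.
  - by move=> b bm; rewrite fullE // full.
  - by rewrite small andbT partE; case/andP: part => *; apply: addr_ge0.
  - by rewrite big_cons partE; lra.
have over0 (P : pred nat) : (forall k, P k -> (m < k)%N) -> \sum_(r <- x :: l | P (beta' r)) h r = 0.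
  move=> Pm; apply: le_anti; rewrite sumr_ge0 ?andbT => [|r _]; last by case/andP: (h01 r).
  apply: (@le_trans _ _ (\sum_(r <- x :: l | (m < beta' r)%N) h r)); last by rewrite overE.
  rewrite [leLHS]big_mkcond [leRHS]big_mkcond; apply: ler_sum => r _.
  have /andP[hr0 _] := h01 r.
  by case: ifP => [/Pm ->//|_]; case: ifP.
exists m.+1, beta'; split.
- move=> b; rewrite ltnS leq_eqVlt => /orP[/eqP->|bm]; last by rewrite fullE // full.
  by rewrite ltW //= partE; case/andP: part; lra.
- by rewrite (over0 (eq_op^~ m.+1)) => [|k /eqP->//]; lra.
- by rewrite (over0 (fun k => (m.+1 < k)%N)) => // k; apply: ltnW.
- rewrite (over0 (eq_op^~ m.+1)) => [|k /eqP->//].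
  rewrite big_cons -natr1; move: big; rewrite partE; case/andP: part; lra.
Qed.

(** * Averaging over the randomness of the tester *)

Lemma sum_probability_le (R : realType) (dd : measure_display)
    (Omega : measurableType dd) (P : probability Omega R) (K : finType)
    (a b : K -> Omega -> bool) (C : nat) :
  (forall k, measurable [set w | a k w]%classic) ->
  (forall k, measurable [set w | b k w]%classic) ->
  (forall w, (\sum_k a k w <= \sum_k b k w + C)%N) ->
  \sum_k fine (P [set w | a k w]%classic) <=
  \sum_k fine (P [set w | b k w]%classic) + C%:R.
Proof.
move=> ma mb ab.
pose ind (e : K -> Omega -> bool) w : \bar R :=
  (\sum_(k <- index_enum K) (\1_[set w | e k w]%classic w)%:E)%E.
have indE e w : ind e w = (\sum_k e k w)%N%:R%:E.
  rewrite /ind sumEFin natr_sum; congr _%:E; apply: eq_bigr => k _.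
  by rewrite indicE; congr (nat_of_bool _)%:R; apply/idP/idP; rewrite inE.
have ind0 e w : (0 <= ind e w)%E by rewrite indE lee_fin.
have mind (e : K -> Omega -> bool) : (forall k, measurable [set w | e k w]%classic) ->
    measurable_fun [set: Omega]%classic (ind e).
  move=> me; apply: emeasurable_sum => k; apply/measurable_EFinP.
  exact: measurable_indic.
have int_ind (e : K -> Omega -> bool) : (forall k, measurable [set w | e k w]%classic) ->
    (\int[P]_w ind e w = (\sum_k fine (P [set w | e k w]%classic))%:E)%E.
  move=> me; rewrite ge0_integral_sum //=.
  - rewrite -sumEFin; apply: eq_bigr => k _.
    by rewrite integral_indic // setIT fineK // fin_num_measure.
  - by move=> k; apply/measurable_EFinP; apply: measurable_indic.
  - by move=> k w _; rewrite lee_fin indicE.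
rewrite -lee_fin EFinD -!int_ind //.
have -> : C%:R%:E = (\int[P]_w (cst C%:R%:E) w)%E.
  by rewrite integral_cst // [X in (_ * X)%E]probability_setT mule1.
rewrite -ge0_integralD //; [|exact: mind|by move=> w _; rewrite lee_fin].
apply: ge0_le_integral => //.
- exact: mind.
- by apply: emeasurable_funD => //; exact: mind.
- by move=> w _; rewrite !indE -EFinD -natrD lee_fin ler_nat.
Qed.

(** The counting bound for each tree is integrated over [Omega] and confronted with the gap between
    acceptance above 2/3 and below 1/3 on unwrapped labelings. *)
Lemma trie_query_bound (R : realType) (n d m : nat) (mu : 'I_d -> 'I_n -> R)
    (y : grid n d -> 'I_m -> bool) (eps : R)
    (dd : measure_display) (Omega : measurableType dd)
    (P : probability Omega R) (T : Omega -> dtree (grid n d)) (q : nat) :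
  (forall x z : grid n d, (forall i, (x i <= z i)%N) -> forall j, y x j ==> y z j) ->
  (forall b i (U : {ffun 'I_m * {ffun 'I_m -> bool} -> 'I_b.+2}),
     unwrapped U -> far_from_monotone mu eps (trie_fun y (Some i) U)) ->
  (forall w, query_bounded q (T w)) ->
  is_monotonicity_tester mu eps P T ->
  (m <= 4 * q)%N.
Proof.
move=> ymono yfar qb [mT [accT rejT]].
pose b := (16 * #|{: 'I_m * {ffun 'I_m -> bool}}|)%N.
pose lab := {ffun 'I_m * {ffun 'I_m -> bool} -> 'I_b.+2}.
pose p c (U : lab) := fine (P [set w | run (T w) (trie_fun y c U)]%classic).
have pE c U : P [set w | run (T w) (trie_fun y c U)]%classic = (p c U)%:E.
  by rewrite fineK // fin_num_measure.
have p01 c U : 0 <= p c U <= 1.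
  by rewrite -!lee_fin -pE measure_ge0 probability_le1.
have pacc U : (unwrapped U)%:R * (2 / 3) <= p None U.
  case gU: (unwrapped U); last by rewrite mul0r; case/andP: (p01 None U).
  rewrite mul1r ltW // -lte_fin -pE; apply: accT => x z xz.
  by apply: trie_fun_mono gU _; apply: ymono.
have prej i U : p (Some i) U <= 1 - (unwrapped U)%:R * (2 / 3).
  case gU: (unwrapped U); last by rewrite mul0r subr0; case/andP: (p01 (Some i) U).
  have := rejT _ (yfar b i U gU).
  have -> : [set w | ~~ run (T w) (trie_fun y (Some i) U)]%classic =
      (~` [set w | run (T w) (trie_fun y (Some i) U)])%classic.
    by apply/seteqP; split=> w /=; [move/negP | move=> ?; apply/negP].
  by rewrite probability_setC // pE -EFinB lte_fin mul1r; lra.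
have countE (e : pred lab) : (\sum_U e U = #|[pred U | e U]|)%N.
  by rewrite -sum1_card [RHS]big_mkcond; apply: eq_bigr => U _; rewrite inE; case: (e U).
have count_le w : (\sum_(k : 'I_m * lab) run (T w) (trie_fun y None k.2) <=
    \sum_(k : 'I_m * lab) run (T w) (trie_fun y (Some k.1) k.2) + q * #|{: lab}|)%N.
  rewrite -(pair_bigA _ (fun i U => nat_of_bool (run (T w) (trie_fun y None U)))) /=.
  rewrite sum_nat_const card_ord countE.
  rewrite -(pair_bigA _ (fun i U => nat_of_bool (run (T w) (trie_fun y (Some i) U)))) /=.
  under [X in (_ <= X + _)%N]eq_bigr do rewrite countE.
  exact: sum_accept (qb w).
have := sum_probability_le P (fun k => mT (trie_fun y None k.2))
  (fun k => mT (trie_fun y (Some k.1) k.2)) count_le.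
set L := #|{: lab}|; pose G := #|@unwrapped m b|.
have sumG : \sum_(U : lab) (unwrapped U)%:R = G%:R :> R.
  by rewrite -natr_sum countE.
have GL : 15 * L%:R <= 16 * G%:R :> R.
  by rewrite -!natrM ler_nat; apply: card_unwrapped; rewrite leqW ?leqW.
have L0 : 0 < L%:R :> R by rewrite ltr0n; apply/card_gt0P; exists [ffun=> 0].
move=> main.
have {main} : m%:R * (G%:R * (2 / 3)) <= m%:R * (L%:R - G%:R * (2 / 3)) + (q * L)%:R :> R.
  apply: le_trans (le_trans main _).
    rewrite -(pair_bigA _ (fun i U => p None U)) /= sumr_const card_ord -[leRHS]mulr_natl.
    by rewrite ler_wpM2l // -sumG mulr_suml; apply: ler_sum => U _.
  rewrite lerD2r -(pair_bigA _ (fun i U => p (Some i) U)) /=.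
  apply: (@le_trans _ _ (\sum_(i < m) (L%:R - G%:R * (2 / 3)))); last first.
    by rewrite sumr_const card_ord -[leLHS]mulr_natl.
  apply: ler_sum => i _; rewrite -sumG mulr_suml.
  have -> : L%:R = \sum_(U : lab) 1 :> R by rewrite sumr_const.
  by rewrite -sumrB; apply: ler_sum.
rewrite natrM => main.
(* From G >= (15/16) L, the inequality (4/3) m G <= m L + q L gives (5/4) m L <= m L + q L, whence
   the factor 4. *)
suff : m%:R * L%:R <= (4 * q%:R) * L%:R :> R by rewrite ler_pM2r // -natrM ler_nat.
have : 0 <= m%:R :> R by [].
by move: main GL L0; set M := m%:R; set g := G%:R; set l := L%:R; set Q := q%:R; clearbody M g l Q; nra.
Qed.

(** * Block bits and distance from monotonicity *)

Section Blocks.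

Variables (R : realType) (n d m : nat) (mu : 'I_d -> 'I_n -> R).
Hypothesis muP : is_prod_distr mu.
Variables (s : bool) (rare : 'I_d -> pred 'I_n) (beta : 'I_d -> nat).
(* The rare sides are all upper intervals (s = false) or all lower ones (s = true). *)
Hypothesis rareP : forall r k k',
  rare r k -> ~~ rare r k' -> if s then (k < k')%N else (k' < k)%N.

(** When the rare sides are lower intervals the flag decreases in [x]; the xor with [s] makes it
    increasing. *)
Definition block_bit (x : grid n d) (i : 'I_m) : bool :=
  flag (fun r => beta r == i) rare x (+) s.

Lemma block_bit_mono (x z : grid n d) (j : 'I_m) :
  (forall i, x i <= z i)%N -> block_bit x j ==> block_bit z j.
Proof.
move=> xz; rewrite /block_bit; move: rareP; case: s => rP.
  rewrite !addbT implybNN; apply/implyP => /existsP[r /andP[br rr]].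
  apply/existsP; exists r; rewrite br /=; apply: contraT => nr.
  by have := rP r _ _ rr nr; rewrite ltnNge xz.
rewrite !addbF; apply/implyP => /existsP[r /andP[br rr]].
apply/existsP; exists r; rewrite br /=; apply: contraT => nr.
by have := rP r _ _ rr nr; rewrite ltnNge xz.
Qed.

(** Moving one coordinate of block [i] to its rare side gives a comparable pair that the exchanged
    function inverts, so [g] differs from it at one of the two points. *)
Lemma trie_fun_far (eps : R) (b : nat) (i : 'I_m)
    (U : {ffun 'I_m * {ffun 'I_m -> bool} -> 'I_b.+2}) :
  eps <= 1 / 10 ->
  1 / 4 <= \sum_(r | beta r == i) rare_mass mu rare r <= 3 / 4 ->
  unwrapped U -> far_from_monotone mu eps (trie_fun block_bit (Some i) U).
Proof.
move=> eps10 /andP[S1 S2] goodU g gmono.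
set f := trie_fun _ _ _.
pose B r := beta r == i.
suff : (\sum_(r | B r) rare_mass mu rare r) * (1 - \sum_(r | B r) rare_mass mu rare r)
    <= prodPr mu (fun x => f x != g x).
  (* On [1/4, 3/4], S (1 - S) >= 3/16 > 1/10. *)
  by move: S1 S2; rewrite -/B; set S := \sum_(r | _) _; clearbody S; nra.
apply: resample_distance => // [|x r k nf br rr]; first by rewrite /B; lra.
have nx : ~~ rare r (x r) by apply: contra nf => rx; apply/existsP; exists r; rewrite br.
have uf : flag B rare (upd x r k).
  by apply/existsP; exists r; rewrite br ffunE eqxx.
have bit_neq : block_bit x i != block_bit (upd x r k) i.
  by rewrite /block_bit -/B uf (negPf nf); case: s.
(* Coordinate [r] lies in block [i] only, so the bits above [i] do not change. *)
have node_eq : trie_node block_bit i x == trie_node block_bit i (upd x r k).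
  apply/trie_nodeP => j ij; rewrite /block_bit; congr (_ (+) _).
  apply: eq_existsb => t; rewrite ffunE; case: (eqVneq t r) => [->|//].
  by rewrite (eqP (br : beta r == i)) ltn_eqF.
apply: contraT; rewrite negb_or !negbK => /andP[/eqP fx /eqP fu].
have := rareP rr nx; move: nf uf bit_neq node_eq; case E: s => nf uf bit_neq node_eq kx.
- have /gmono : forall t, (upd x r k t <= x t)%N.
    by move=> t; rewrite ffunE; case: (eqVneq t r) => [->|//]; apply: ltnW.
  rewrite -fx -fu leqNgt => /negP[]; apply: (@trie_fun_lt _ _ _ _ _ _ i) => //.
    by rewrite /separates node_eq.
  by rewrite eqxx /block_bit -/B (negPf nf) E.
- have /gmono : forall t, (x t <= upd x r k t)%N.
    by move=> t; rewrite ffunE; case: (eqVneq t r) => [->|//]; apply: ltnW.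
  rewrite -fx -fu leqNgt => /negP[]; apply: (@trie_fun_lt _ _ _ _ _ _ i) => //.
    by rewrite /separates eq_sym node_eq eq_sym.
  by rewrite eqxx /block_bit -/B uf E.
Qed.

End Blocks.

(** * Thresholds and the final constants *)

Lemma theta_r_attained (R : realType) (n d : nat) (mu : 'I_d -> 'I_n -> R) (r : 'I_d) :
  is_prod_distr mu -> exists j, theta_r mu r = theta_rj mu r j.
Proof.
move=> [mu0 mu1].
have cdf01 j : 0 <= Defs.cdf mu r j <= 1.
  rewrite sumr_ge0 //= -(mu1 r) [leRHS](bigID (fun k : 'I_n => (k <= j)%N)) /= lerDl.
  exact: sumr_ge0.
(* Total mass 1 forces ['I_n] to be inhabited, so the maximum with default 0 is attained. *)
have [j0 _] : exists j0 : 'I_n, True.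
  case: (pickP (@predT 'I_n)) => [j _|none]; first by exists j.
  by have := mu1 r; rewrite big_pred0 // => /esym/eqP; rewrite oner_eq0.
have [|j _ jE] := @eq_bigmax _ _ _ 0 j0 predT (theta_rj mu r) isT; last by exists j.
by move=> j _; rewrite /theta_rj le_min subr_ge0.
Qed.

(* Omega(sum_r theta_r): there are absolute constants c > 0 and N such that
   whenever sum_r theta_r >= N, every such tester with worst-case query
   bound q satisfies q >= c * sum_r theta_r. *)
Theorem theorem5p15 :
  forall R : realType,
  exists c : R, 0 < c /\ exists N : R,
  forall (n d : nat) (mu : 'I_d -> 'I_n -> R),
    is_prod_distr mu ->
  forall eps : R, eps <= 1 / 10 ->
  forall (dd : measure_display) (Omega : measurableType dd)
         (P : probability Omega R) (T : Omega -> dtree (grid n d)) (q : nat),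
    (forall w, query_bounded q (T w)) ->
    is_monotonicity_tester mu eps P T ->
    N <= \sum_(r < d) theta_r mu r ->
    c * (\sum_(r < d) theta_r mu r) <= q%:R.
Proof.
(* With s the sum of the theta_r: s/2 <= (3/4) m + 1/4 <= 3 q + 1/4, and s >= 1 absorbs 1/4 into
   s/4, leaving s/4 <= 3 q. *)
move=> R; exists (1 / 12); split; first by lra.
exists 1 => n d mu muP eps eps10 dd Omega P T q qb tester N1.
have [thr thrP] := choice (fun r => theta_r_attained r muP).
pose low r := Defs.cdf mu r (thr r) <= 1 - Defs.cdf mu r (thr r).
(* A coordinate of the other orientation gets an empty rare side, hence mass 0. *)
pose rare (s : bool) r : pred 'I_n :=
  fun k => (low r == s) && (if s then k <= thr r else thr r < k)%N.
have rareP s r k k' : rare s r k -> ~~ rare s r k' -> if s then (k < k')%N else (k' < k)%N.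
  rewrite /rare; case: eqP => //= _; case: s => kt; first by rewrite -ltnNge; apply: leq_ltn_trans.
  by rewrite -leqNgt => k't; apply: leq_ltn_trans kt.
have massE s r : rare_mass mu (rare s) r = if low r == s then theta_r mu r else 0.
  rewrite /rare_mass /rare thrP /theta_rj.
  case: eqP => [<-|_]; last by rewrite big_pred0.
  case lr: (low r) => /=; first by rewrite min_l.
  rewrite min_r; last by rewrite ltW // ltNge -/(low r) lr.
  have := muP.2 r; rewrite (bigID (fun k : 'I_n => (k <= thr r)%N)) /= => <-.
  by rewrite addrAC subrr add0r; apply: eq_bigl => k; rewrite ltnNge.
have [s half] : exists s, (\sum_r theta_r mu r) / 2 <= \sum_r rare_mass mu (rare s) r.
  have : \sum_r theta_r mu r =
      \sum_r rare_mass mu (rare true) r + \sum_r rare_mass mu (rare false) r.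
    rewrite -big_split; apply: eq_bigr => r _; rewrite !massE.
    by case: (low r); rewrite /= ?addr0 ?add0r.
  move=> sumE.
  have [|lt] := leP ((\sum_r theta_r mu r) / 2) (\sum_r rare_mass mu (rare true) r).
    by exists true.
  by exists false; lra.
have mass01 r : 0 <= rare_mass mu (rare s) r <= 1 / 2.
  rewrite rare_mass_ge0 //= massE; case: ifP => _; last by lra.
  rewrite thrP /theta_rj.
  by set e := Defs.cdf _ _ _; case: (leP e (1 - e)); lra.
have [m [beta [full /andP[_ part] _ tot]]] :=
  greedy_blocks (index_enum_uniq 'I_d) mass01.
have mq : (m <= 4 * q)%N.
  apply: (trie_query_bound (y := @block_bit n d m s (rare s) beta) _ _ qb tester).
    by move=> x z xz j; apply: block_bit_mono xz; apply: rareP.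
  move=> b i U; apply: trie_fun_far => //; first exact: rareP.
  by apply: full.
have : m%:R <= 4 * q%:R :> R by rewrite -natrM ler_nat.
by move: half part tot N1 => /=; lra.
Qed.
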